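(* Let $N\ge1$. The truncated Fourier-Galerkin problem $$\dot q_N(t)=p_N(t),\qquad \dot p_N(t)=-D_Nq_N(t)-\int_0^1\omega_N(x)f'(\omega_N(x)^\top q_N(t))\,dx,\qquad t>0,$$ with $q_N(t),p_N(t)\in\mathbb{R}^{2N+1}$, is Hamiltonian (i.e. of the form $\dot q_N=\nabla_{p_N}H_N$, $\dot p_N=-\nabla_{q_N}H_N$), with Hamiltonian $$H_N(q_N,p_N)=\frac12p_N^\top p_N+\frac12q_N^\top D_Nq_N+\int_0^1f(\omega_N(x)^\top q_N)\,dx.$$
   Context: $f:\mathbb{R}\to\mathbb{R}$ is a suitably regular function. Let $c_0(x)\equiv1$, $c_n(x)=\sqrt2\cos(2n\pi x)$, $s_n(x)=\sqrt2\sin(2n\pi x)$ for $n\ge1$. Then $$\omega_N(x)=(c_0(x),c_1(x),s_1(x),c_2(x),s_2(x),\dots,c_N(x),s_N(x))^\top\in\mathbb{R}^{2N+1},$$ $$D_N=\mathrm{diag}\big(0,(2\pi)^2,(2\pi)^2,(4\pi)^2,(4\pi)^2,\dots,(2N\pi)^2,(2N\pi)^2\big)\in\mathbb{R}^{(2N+1)\times(2N+1)}.$$ The problem is the Fourier-Galerkin space semi-discretization of $u_{tt}=u_{xx}-f'(u)$ on $(0,1)$ with periodic boundary conditions, with $u\approx u_N(x,t)=\omega_N(x)^\top q_N(t)$. *)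

(* Defs.v *)
From mathcomp Require Import all_boot all_order all_algebra.
From mathcomp Require Import all_classical all_reals all_analysis.

Set Implicit Arguments.
Unset Strict Implicit.
Unset Printing Implicit Defensive.

Import Order.TTheory GRing.Theory Num.Theory.
Import numFieldNormedType.Exports.

Local Open Scope ring_scope.
Local Open Scope classical_set_scope.

Definition C1 (R : realType) (f : R -> R) : Prop :=
  (forall x, derivable f x 1) /\ continuous (derive1 f).

Definition cosb (R : realType) (n : nat) (x : R) : R :=
  if n is 0%N then 1 else Num.sqrt 2 * cos (2 * n%:R * pi * x).

Definition sinb (R : realType) (n : nat) (x : R) : R :=
  Num.sqrt 2 * sin (2 * n%:R * pi * x).

(* Coordinate 0 has frequency 0; for n >= 1 the coordinates 2n-1 and 2n have
   frequency n.  So coordinate i has frequency [uphalf i], and carries a cosine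
   exactly when i = 0 or i is odd. *)
Definition omega (R : realType) (N : nat) (x : R) : 'cV[R]_(2 * N).+1 :=
  \col_i (if (i == 0 :> nat) || odd i then cosb (uphalf i) x
          else sinb (uphalf i) x).

Definition Dmx (R : realType) (N : nat) : 'M[R]_((2 * N).+1) :=
  diag_mx (\row_i (2 * (uphalf i)%:R * pi) ^+ 2).

Definition dotv (R : realType) (m : nat) (u v : 'cV[R]_m) : R :=
  (u^T *m v) 0 0.

Definition nonlin (R : realType) (f : R -> R) (N : nat)
    (q : 'cV[R]_(2 * N).+1) : 'cV[R]_(2 * N).+1 :=
  \col_i \int[lebesgue_measure]_(x in `[0, 1])
    (omega N x i 0 * derive1 f (dotv (omega N x) q)).

Definition HN (R : realType) (f : R -> R) (N : nat)
    (q p : 'cV[R]_(2 * N).+1) : R :=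
  2^-1 * dotv p p + 2^-1 * dotv q (Dmx R N *m q)
  + \int[lebesgue_measure]_(x in `[0, 1]) f (dotv (omega N x) q).

(* As ['D_v] is total, the vector of partial derivatives is meaningful only
   where F is differentiable. *)
Definition grad (R : realType) (m : nat) (F : 'cV[R]_m.+1 -> R)
    (x : 'cV[R]_m.+1) : 'cV[R]_m.+1 :=
  \col_i 'D_(delta_mx i 0) F x.

Definition galerkin_problem (R : realType) (f : R -> R) (N : nat)
    (q p : R -> 'cV[R]_(2 * N).+1) : Prop :=
  forall t : R, 0 < t ->
    is_derive t 1 q (p t) /\
    is_derive t 1 p (- (Dmx R N *m q t) - nonlin f (q t)).

Definition hamilton_equations (R : realType) (m : nat)
    (H : 'cV[R]_m.+1 -> 'cV[R]_m.+1 -> R) (q p : R -> 'cV[R]_m.+1) : Prop :=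
  forall t : R, 0 < t ->
    is_derive t 1 q (grad (fun p' => H (q t) p') (p t)) /\
    is_derive t 1 p (- grad (fun q' => H q' (p t)) (q t)).

(* Main.v *)
(* Only the gradient of q |-> \int f(omega(x)^T q) dx needs work.  By the mean
   value theorem the Taylor remainder of f at omega(x)^T q in the increment
   omega(x)^T h is at most e |h| as soon as f' oscillates by at most a multiple
   of e, and compactness of [0, 1] makes this hold for all small h uniformly
   in x; integrating over x gives Frechet differentiability. *)
From HB Require Import structures.
Require Import Defs.
From mathcomp Require Import all_boot all_order all_algebra.
From mathcomp Require Import all_classical all_reals all_analysis.
From mathcomp Require Import ring lra.
Set Implicit Arguments.
Unset Strict Implicit.
Unset Printing Implicit Defensive.
Import Order.TTheory GRing.Theory Num.Theory.
Import numFieldNormedType.Exports.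
Local Open Scope ring_scope.
Local Open Scope classical_set_scope.

(** * The pairing [dotv], the maximum norm, and a one-variable remainder bound *)

Lemma dotvE (R : realType) (m : nat) (u v : 'cV[R]_m) :
  dotv u v = \sum_i u i 0 * v i 0.
Proof. by rewrite /dotv mxE; apply: eq_bigr => i _; rewrite mxE. Qed.

Lemma dotvC (R : realType) (m : nat) (u v : 'cV[R]_m) : dotv u v = dotv v u.
Proof. by rewrite !dotvE; apply: eq_bigr => i _; rewrite mulrC. Qed.

Lemma dotvDr (R : realType) (m : nat) (u v w : 'cV[R]_m) :
  dotv u (v + w) = dotv u v + dotv u w.
Proof. by rewrite /dotv mulmxDr mxE. Qed.

Lemma dotv_is_linear (R : realType) (m : nat) (u : 'cV[R]_m) :
  linear (dotv u : 'cV[R]_m -> R).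
Proof. by move=> a v w; rewrite /dotv mulmxDr -scalemxAr !mxE. Qed.

Lemma dotv_delta (R : realType) (m : nat) (u : 'cV[R]_m) (i : 'I_m) :
  dotv u (delta_mx i 0) = u i 0.
Proof.
rewrite dotvE (bigD1 i)//= mxE !eqxx mulr1 big1 ?addr0// => j ji.
by rewrite mxE (negbTE ji) mulr0.
Qed.

Lemma dotv_mulmx (R : realType) (m : nat) (A : 'M[R]_m) (u v : 'cV[R]_m) :
  dotv u (A *m v) = dotv (A^T *m u) v.
Proof. by rewrite /dotv trmx_mul trmxK mulmxA. Qed.

Lemma normr_coord_le (R : realType) (m n : nat) (v : 'M[R]_(m, n)) i j :
  `|v i j| <= `|v|.
Proof.
rewrite [leRHS]mx_normrE.
exact: (le_bigmax 0 (fun ij : 'I_m * 'I_n => `|v ij.1 ij.2|) (i, j)).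
Qed.

(** Hölder's inequality with exponents 1 and infinity: the norm of a column vector here is its
    largest coordinate modulus, so the dual 1-norm appears on [u]. *)
Lemma normr_dotv_le (R : realType) (m : nat) (u v : 'cV[R]_m) :
  `|dotv u v| <= (\sum_i `|u i 0|) * `|v|.
Proof.
rewrite dotvE mulr_suml (le_trans (ler_norm_sum _ _ _))//.
by apply: ler_sum => i _; rewrite normrM ler_wpM2l// normr_coord_le.
Qed.

Lemma continuous_dotv (R : realType) (T : topologicalType) (m : nat)
    (u v : T -> 'cV[R]_m) :
  (forall i, continuous (fun x => u x i 0)) ->
  (forall i, continuous (fun x => v x i 0)) ->
  continuous (fun x => dotv (u x) (v x)).
Proof.
move=> cu cv; under eq_fun do rewrite dotvE.
apply: continuous_big => [|i _ x]; first exact: add_continuous.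
by apply: cvgM; [exact: cu|exact: cv].
Qed.

Lemma Rintegral_sum (d : measure_display) (T : measurableType d) (R : realType)
    (mu : {measure set T -> \bar R}) (D : set T) (m : nat)
    (F : 'I_m -> T -> R) :
  measurable D -> (forall i, mu.-integrable D (EFin \o F i)) ->
  \int[mu]_(x in D) (\sum_i F i x) = \sum_i \int[mu]_(x in D) F i x.
Proof.
move=> mD iF; rewrite /Rintegral.
under eq_integral do rewrite -sumEFin.
rewrite (@integral_sum _ _ _ mu D mD _ (fun i => EFin \o F i) iF).
by rewrite -sum_fine// => i _; exact: integrable_fin_num.
Qed.

(** The mean value theorem turns the increment of [f] into [derive1 f c * b] with [c] between [a]
    and [b + a], so the remainder is [(derive1 f c - derive1 f a) * b]. *)
Lemma C1_taylor (R : realType) (f : R -> R) (a b e : R) : C1 f ->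
  (forall c, `|c - a| <= `|b| -> `|derive1 f c - derive1 f a| <= e) ->
  `|f (b + a) - f a - derive1 f a * b| <= e * `|b|.
Proof.
move=> [df _] fe.
have fdf (x : R) : is_derive x 1 f (derive1 f x).
  by rewrite derive1E; exact: derivableP.
have cf (x : R) : {for x, continuous f}.
  by apply: differentiable_continuous; apply/derivable1_diffP.
have [c ca ->] : exists2 c, `|c - a| <= `|b| &
    f (b + a) - f a = derive1 f c * b.
  (* [MVT_segment] takes ordered endpoints, hence the split on the sign of [b]. *)
  have [b0|b0] := leP 0 b.
    have [||c cI fE] := @MVT_segment _ f (derive1 f) a (b + a).
    - by rewrite lerDr.
    - exact: continuous_subspaceT.
    move: cI; rewrite in_itv/= => /andP[ac cb]; exists c.
      by rewrite !ger0_norm ?subr_ge0// lerBlDr.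
    by rewrite fE addrK.
  have [||c cI fE] := @MVT_segment _ f (derive1 f) (b + a) a.
  - by rewrite gerDr ltW.
  - exact: continuous_subspaceT.
  move: cI; rewrite in_itv/= => /andP[bc ca]; exists c.
    by rewrite ler0_norm ?subr_le0// ltr0_norm// lerN2 lerBrDr.
  by rewrite -opprB fE; ring.
by rewrite -mulrBl normrM ler_wpM2r// fe.
Qed.

(** * Gradients from first-order expansions *)

Lemma differentiable_grad (R : realType) (m : nat) (F : 'cV[R]_m.+1 -> R)
    (x g : 'cV[R]_m.+1) :
  (forall e, 0 < e ->
    \forall h \near (0 : 'cV[R]_m.+1),
      `|F (h + x) - F x - dotv g h| <= e * `|h|) ->
  differentiable F x /\ grad F x = g.
Proof.
move=> Fg.
(* [dotv g] is the candidate differential; it is bundled as a linear map so that [diff_unique] can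
   identify it with ['d F x]. *)
pose gL : {linear 'cV[R]_m.+1 -> R} :=
  HB.pack (dotv g) (GRing.isLinear.Build _ _ _ _ _ (@dotv_is_linear _ _ g)).
have cg : continuous gL.
  apply: continuous_dotv => i; [exact: cst_continuous|exact: coord_continuous].
have Fo : F \o shift x = cst (F x) + gL +o_ (0 : 'cV[R]_m.+1) id.
  apply/eqaddoP => e e0; near=> h.
  rewrite !fctE /= opprD addrA; near: h; exact: Fg.
have dF : 'd F x = gL :> (_ -> _) by apply: diff_unique.
have Fx : differentiable F x by apply/diff_locallyP; rewrite dF.
(* Partial derivatives are the values of the differential [dotv g] at the basis vectors, that is,
   the coordinates of [g]. *)
split=> //; apply/matrixP => i j; rewrite ord1 mxE deriveE// dF /=.
exact: dotv_delta.
Unshelve. all: by end_near. Qed.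

(** Symmetry merges the two cross terms into [dotv (A *m x) h]; what remains is the form evaluated
    at [h], which is of second order. *)
Lemma differentiable_grad_quadratic (R : realType) (m : nat)
    (A : 'M[R]_m.+1) (x : 'cV[R]_m.+1) : A^T = A ->
  differentiable (fun y => 2^-1 * dotv y (A *m y)) x /\
  grad (fun y => 2^-1 * dotv y (A *m y)) x = A *m x.
Proof.
move=> AT; apply: differentiable_grad => e e0.
pose M := 2^-1 * \sum_i \sum_j `|A i j|.
have M0 : 0 <= M by rewrite mulr_ge0// sumr_ge0// => i _; rewrite sumr_ge0.
near=> h.
have -> : 2^-1 * dotv (h + x) (A *m (h + x)) - 2^-1 * dotv x (A *m x) -
    dotv (A *m x) h = 2^-1 * dotv h (A *m h).
  rewrite mulmxDr dotvDr !(dotvC (h + x)) !dotvDr !(dotvC (A *m _)).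
  by rewrite [dotv x (A *m h)]dotv_mulmx AT [dotv (A *m x) h]dotvC; field.
apply: (@le_trans _ _ (M * `|h| * `|h|)).
  rewrite normrM ger0_norm ?invr_ge0// -!mulrA ler_wpM2l ?invr_ge0//.
  rewrite dotvC (le_trans (normr_dotv_le _ _))// mulrA ler_wpM2r// mulr_suml.
  apply: ler_sum => i _.
  rewrite mxE (le_trans (ler_norm_sum _ _ _))// mulr_suml.
  by apply: ler_sum => j _; rewrite normrM ler_wpM2l// normr_coord_le.
rewrite ler_wpM2r//.
(* [M + 1] keeps the denominator positive even when [A] is zero. *)
have : `|h| <= e / (M + 1).
  by near: h; apply: (@nbhs0_le _ 'cV[R]_m.+1); rewrite divr_gt0// ltr_wpDl.
rewrite ler_pdivlMr; last by rewrite ltr_wpDl.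
by have := normr_ge0 h; have := M0; nra.
Unshelve. all: by end_near. Qed.

(** * Differentiation under the integral sign *)

Lemma near_compact_taylor (R : realType) (f : R -> R) (m : nat)
    (w : R -> 'cV[R]_m.+1) (K : set R) (q : 'cV[R]_m.+1) (e : R) :
  C1 f -> compact K -> (forall i, continuous (fun x => w x i 0)) -> 0 < e ->
  \forall h \near (0 : 'cV[R]_m.+1), forall x, K x ->
    `|f (dotv (w x) (h + q)) - f (dotv (w x) q) -
      derive1 f (dotv (w x) q) * dotv (w x) h| <= e * `|h|.
Proof.
move=> hf cK cw e0.
have [_ cf'] := hf.
have cwq : continuous (fun x => dotv (w x) q).
  by apply: continuous_dotv => // i; exact: cst_continuous.
have cS : continuous (fun x => \sum_i `|w x i 0|).
  apply: continuous_big => [|i _ x]; first exact: add_continuous.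
  by apply: cvg_norm; exact: cw.
(* By the near-covering form of compactness, it suffices to have the estimate for [x'] near a fixed
   [x] and [h] near 0 jointly. *)
apply: ((compact_near_coveringP K).1 cK _ (nbhs (0 : 'cV[R]_m.+1))
  (fun h x => `|f (dotv (w x) (h + q)) - f (dotv (w x) q) -
    derive1 f (dotv (w x) q) * dotv (w x) h| <= e * `|h|)) => x Kx.
(* The added 1 lets [M] bound the 1-norm of [w x'] for all [x'] near [x]. An oscillation of [e / M]
   for the derivative of [f] then costs at most [e * |h|]. *)
pose M := \sum_i `|w x i 0| + 1.
have M0 : 0 < M by rewrite ltr_wpDl// sumr_ge0.
have eM : 0 < e / M by rewrite divr_gt0.
have [r /= r0 f'r] : exists2 r : R, 0 < r & forall y,
    `|y - dotv (w x) q| < r ->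
    `|derive1 f y - derive1 f (dotv (w x) q)| < e / M / 2.
  have /cvgrPdist_lt/(_ _ (divr_gt0 eM (ltr0n _ 2))) := cf' (dotv (w x) q).
  case/nbhs_ballP => r /= r0 rf; exists r => // y yr.
  by rewrite distrC; apply: rf; rewrite /ball/= distrC.
(* Half of [r] pays for moving from [x] to [x'], the other half for the increment
   [dotv (w x') h]. *)
have r2 : 0 < r / 2 by rewrite divr_gt0.
near=> x' h.
have Sx' : \sum_i `|w x' i 0| <= M.
  rewrite /M -lerBlDl.
  apply: le_trans (ler_norm _) _; near: x'.
  have /cvgrPdist_le/(_ _ ltr01) := cS x.
  by apply: filterS => y; rewrite distrC.
have wx'q : `|dotv (w x') q - dotv (w x) q| < r / 2.
  near: x'; have /cvgrPdist_lt/(_ _ r2) := cwq x.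
  by apply: filterS => y; rewrite distrC.
have wx'h : `|dotv (w x') h| <= M * `|h|.
  by rewrite (le_trans (normr_dotv_le _ _))// ler_wpM2r.
have hr : `|h| < r / 2 / M.
  by near: h; apply: (@nbhs0_lt _ 'cV[R]_m.+1); rewrite divr_gt0.
have {}hr : M * `|h| < r / 2 by rewrite mulrC -ltr_pdivlMr.
rewrite dotvDr.
apply: (@le_trans _ _ (e / M * `|dotv (w x') h|)); last first.
  apply: (@le_trans _ _ (e / M * (M * `|h|))); first by rewrite ler_wpM2l// ltW.
  by rewrite mulrA divfK// gt_eqF.
apply: C1_taylor => // c ch.
(* Both points are compared with the center x of the covering neighborhood. *)
rewrite (_ : _ - _ = (derive1 f c - derive1 f (dotv (w x) q)) -
  (derive1 f (dotv (w x') q) - derive1 f (dotv (w x) q))); last by ring.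
rewrite (le_trans (ler_normB _ _))// [leRHS]splitr.
apply: lerD; apply/ltW/f'r; last first.
  by rewrite (lt_trans wx'q)// [ltRHS]splitr ltrDl.
rewrite (_ : _ - _ = (c - dotv (w x') q) + (dotv (w x') q - dotv (w x) q));
  last by ring.
rewrite (le_lt_trans (ler_normD _ _))// [ltRHS]splitr ler_ltD//.
by rewrite (le_trans ch)// (le_trans wx'h)// ltW.
Unshelve. all: by end_near. Qed.

Lemma differentiable_grad_integral (R : realType) (f : R -> R) (m : nat)
    (w : R -> 'cV[R]_m.+1) (K : set R) (q : 'cV[R]_m.+1) :
  C1 f -> compact K -> (forall i, continuous (fun x => w x i 0)) ->
  differentiable
    (fun q => \int[lebesgue_measure]_(x in K) f (dotv (w x) q)) q /\
  grad (fun q => \int[lebesgue_measure]_(x in K) f (dotv (w x) q)) q =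
  \col_i \int[lebesgue_measure]_(x in K)
    (w x i 0 * derive1 f (dotv (w x) q)).
Proof.
move=> hf cK cw; have [df cf'] := hf.
have mK : measurable K by exact: measurable_realfun.compact_measurable.
have intK (g : R -> R) : continuous g ->
    lebesgue_measure.-integrable K (EFin \o g).
  move=> cg; apply: continuous_compact_integrable => //.
  exact: continuous_subspaceT.
have cf : continuous f.
  by move=> x; apply: differentiable_continuous; apply/derivable1_diffP.
have cdot v : continuous (fun x => dotv (w x) v).
  by apply: continuous_dotv => // i; exact: cst_continuous.
have cfdot v : continuous (fun x => f (dotv (w x) v)).
  by move=> x; apply: continuous_comp; [exact: cdot|exact: cf].
have cf'dot : continuous (fun x => derive1 f (dotv (w x) q)).
  by move=> x; apply: continuous_comp; [exact: cdot|exact: cf'].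
apply: differentiable_grad => e e0.
pose V := fine (lebesgue_measure K).
have V0 : 0 <= V by exact: fine_ge0.
(* A pointwise tolerance of [e / (V + 1)] integrates over [K] to at most [e]; adding 1 covers a null
   set [K]. *)
have eV : 0 < e / (V + 1) by rewrite divr_gt0// ltr_wpDl.
near=> h.
(* Moving the linear term inside makes the whole remainder one integral, to be bounded pointwise. *)
have dE : dotv (\col_i \int[lebesgue_measure]_(x in K)
      (w x i 0 * derive1 f (dotv (w x) q))) h =
    \int[lebesgue_measure]_(x in K) (derive1 f (dotv (w x) q) * dotv (w x) h).
  rewrite dotvE; under [RHS]eq_Rintegral do rewrite [dotv _ h]dotvE mulr_sumr.
  rewrite Rintegral_sum//; last first.
    move=> i; apply: intK => x; apply: cvgM; first exact: cf'dot.
    by apply: cvgM; [exact: cw|exact: cvg_cst].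
  apply: eq_bigr => i _; rewrite mxE -RintegralZr//; last first.
    by apply: intK => x; apply: cvgM; [exact: cw|exact: cf'dot].
  by apply: eq_Rintegral => x _; ring.
rewrite dE -RintegralB; [|by []|exact/intK/cfdot..].
rewrite -RintegralB; [|by []| |]; last 2 first.
  apply: intK => x; apply: cvgB; exact: cfdot.
  by apply: intK => x; apply: cvgM; [exact: cf'dot|exact: cdot].
have cR : continuous (fun x => f (dotv (w x) (h + q)) - f (dotv (w x) q) -
    derive1 f (dotv (w x) q) * dotv (w x) h).
  move=> x; apply: cvgB; first by apply: cvgB; exact: cfdot.
  by apply: cvgM; [exact: cf'dot|exact: cdot].
apply: le_trans; first by apply: le_normr_Rintegral => //; exact: intK.
apply: (@le_trans _ _ (\int[lebesgue_measure]_(x in K) (e / (V + 1) * `|h|))).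
  apply: le_Rintegral => //.
  - by apply: intK => x; apply: cvg_norm; exact: cR.
  - by apply: intK => x; exact: cvg_cst.
  - by near: h; exact: near_compact_taylor.
rewrite Rintegral_cst// mulrAC ler_wpM2r// -/V mulrAC ler_pdivrMr ?ltr_wpDl//.
by rewrite ler_wpM2l ?lerDl// ltW.
Unshelve. all: by end_near. Qed.

(** * The Fourier basis and Hamilton's equations *)

Lemma continuous_omega (R : realType) (N : nat) (i : 'I_(2 * N).+1) :
  continuous (fun x : R => omega N x i 0).
Proof.
have ctrig (g : R -> R) (c a : R) : continuous g ->
    continuous (fun x => c * g (a * x)).
  move=> cg x; apply: cvgM; first exact: cvg_cst.
  apply: continuous_comp; last exact: cg.
  by apply: cvgM; [exact: cvg_cst|exact: cvg_id].
under eq_fun do rewrite mxE.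
case: ((i == 0 :> nat) || odd i); last exact/ctrig/continuous_sin.
rewrite /cosb; case: (uphalf i) => [|n]; first exact: cst_continuous.
exact/ctrig/continuous_cos.
Qed.

Lemma gradD (R : realType) (m : nat) (F G : 'cV[R]_m.+1 -> R) x :
  differentiable F x -> differentiable G x ->
  grad (fun y => F y + G y) x = grad F x + grad G x.
Proof.
move=> dF dG; apply/matrixP => i j; rewrite !mxE.
by rewrite (deriveD (diff_derivable dF) (diff_derivable dG)).
Qed.

Lemma grad_cst (R : realType) (m : nat) (c : R) (x : 'cV[R]_m.+1) :
  grad (fun=> c) x = 0.
Proof. by apply/matrixP => i j; rewrite !mxE derive_cst. Qed.

Theorem theorem6 (R : realType) (f : R -> R) (hf : C1 f) (N : nat)
    (hN : (1 <= N)%N) :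
  [/\ (* the Hamiltonian is differentiable on the whole phase space *)
      (forall z : 'cV[R]_(2 * N).+1 * 'cV[R]_(2 * N).+1,
         differentiable
           (fun z : 'cV[R]_(2 * N).+1 * 'cV[R]_(2 * N).+1 => HN f z.1 z.2) z),
      (* the right-hand sides of the problem are grad_p H and - grad_q H *)
      (forall q p : 'cV[R]_(2 * N).+1,
         p = grad (fun p' => HN f q p') p /\
         - (Dmx R N *m q) - nonlin f q = - grad (fun q' => HN f q' p) q) &
      (* the problem is the system of Hamilton's equations of H *)
      (forall q p : R -> 'cV[R]_(2 * N).+1,
         galerkin_problem f q p <-> hamilton_equations (@HN R f N) q p)].
Proof.
(* The kinetic energy is the quadratic form of the identity matrix. *)
have KE : (fun y : 'cV[R]_(2 * N).+1 => 2^-1 * dotv y (1%:M *m y)) =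
    fun y => 2^-1 * dotv y y by apply/funext => y; rewrite mul1mx.
have dgK (p : 'cV[R]_(2 * N).+1) :
    differentiable (fun y => 2^-1 * dotv y y) p /\
    grad (fun y => 2^-1 * dotv y y) p = p.
  have := @differentiable_grad_quadratic R _ 1%:M p (trmx1 _ _).
  by rewrite KE mul1mx.
have dgD := @differentiable_grad_quadratic R _ (Dmx R N) ^~ (tr_diag_mx _).
(* With [omega] on [0, 1], the gradient obtained is [nonlin f q] up to unfolding. *)
have dgI q := differentiable_grad_integral q hf (@segment_compact R 0 1)
  (@continuous_omega R N).
have cst_diff (c : R) (q : 'cV[R]_(2 * N).+1) : differentiable (fun=> c) q.
  exact: differentiable_cst.
have gp (q p : 'cV[R]_(2 * N).+1) : grad (fun p' => HN f q p') p = p.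
  have [dK gK] := dgK p.
  rewrite /HN gradD//; last exact: differentiableD.
  by rewrite gradD// gK !grad_cst !addr0.
have gq (q p : 'cV[R]_(2 * N).+1) :
    grad (fun q' => HN f q' p) q = Dmx R N *m q + nonlin f q.
  have [dD gD] := dgD q; have [dI gI] := dgI q.
  rewrite /HN gradD//; last exact: differentiableD.
  by rewrite gradD// grad_cst add0r gD gI.
have gqN (q p : 'cV[R]_(2 * N).+1) :
    - (Dmx R N *m q) - nonlin f q = - grad (fun q' => HN f q' p) q.
  by rewrite gq opprD.
split=> [z|q p|q p]; last 2 first.
- by rewrite gp.
- by split=> H t /H; rewrite gp (gqN (q t) (p t)).
(* [gp] and [gq] vary one argument at a time. For joint differentiability, each summand of [HN]
   depends on [q] alone or on [p] alone, so it factors through a projection. *)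
have dfst : differentiable
    (fst : 'cV[R]_(2 * N).+1 * 'cV[R]_(2 * N).+1 -> 'cV[R]_(2 * N).+1) z.
  by apply: linear_differentiable => x; exact: cvg_fst.
have dsnd : differentiable
    (snd : 'cV[R]_(2 * N).+1 * 'cV[R]_(2 * N).+1 -> 'cV[R]_(2 * N).+1) z.
  by apply: linear_differentiable => x; exact: cvg_snd.
apply: differentiableD; first apply: differentiableD.
- exact: (differentiable_comp dsnd (proj1 (dgK z.2))).
- exact: (differentiable_comp dfst (proj1 (dgD z.1))).
- exact: (differentiable_comp dfst (proj1 (dgI z.1))).
Qed.
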